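(* Let $G$ be a finite group with pseudo-exponent $\alpha=\alpha(G)$, let $\gamma=\gamma(G)$, and let $\omega$ be the exponent of matrix multiplication over $\mathbb{C}$. If $\alpha(G)<\gamma(G)$, then $$\omega\le\alpha\left(\frac{\gamma-2}{\gamma-\alpha}\right),$$ where for $\gamma=\infty$ the fraction $\frac{\gamma-2}{\gamma-\alpha}$ is interpreted as $1$.
   Context: For a subset $S$ of a group, $Q(S)=\{s_1s_2^{-1}: s_1,s_2\in S\}$. A group $G$ realizes $\langle n_1,n_2,n_3\rangle$ if there are subsets $S_1,S_2,S_3\subseteq G$ with $|S_i|=n_i$ such that for all $q_i\in Q(S_i)$, if $q_1q_2q_3=1$ then $q_1=q_2=q_3=1$. The pseudo-exponent $\alpha(G)$ of a non-trivial finite group $G$ is the minimum of $\frac{3\log|G|}{\log nmp}$ over all positive integers $n,m,p$ (not all $1$) such that $G$ realizes $\langle n,m,p\rangle$; the pseudo-exponent of the trivial group is $3$. For a finite group $G$, $\gamma(G)$ is defined so that $|G|^{1/\gamma(G)}$ is the maximum character degree of $G$ (the largest dimension of an irreducible complex representation), with $\gamma(G)=\infty$ if $G$ is abelian. The exponent $\omega$ is the smallest real number such that for each $\varepsilon>0$, two $n\times n$ complex matrices can be multiplied using $O(n^{\omega+\varepsilon})$ arithmetic operations. *)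

(* Defs.v *)
From HB Require Import structures.
From mathcomp Require Import all_boot all_order all_algebra.
From mathcomp Require Import all_fingroup all_solvable all_character.
From mathcomp Require Import all_classical all_reals all_analysis.
From mathcomp Require Import complex ring lra.
Import Order.TTheory GRing.Theory Num.Theory.
Import numFieldNormedType.Exports.

Set Implicit Arguments.
Unset Strict Implicit.
Unset Printing Implicit Defensive.

Local Open Scope classical_set_scope.
Local Open Scope ring_scope.

Definition quotients (gT : finGroupType) (S : {set gT}) : {set gT} :=
  [set (x * y^-1)%g | x in S, y in S].

Definition realizes (gT : finGroupType) (G : {group gT}) (n m p : nat) : Prop :=
  exists S1 S2 S3 : {set gT},
    [/\ [/\ S1 \subset G, S2 \subset G & S3 \subset G],
        [/\ #|S1| = n, #|S2| = m & #|S3| = p] &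
        forall q1 q2 q3 : gT, q1 \in quotients S1 -> q2 \in quotients S2 ->
          q3 \in quotients S3 -> (q1 * q2 * q3 = 1)%g ->
          [/\ q1 = 1%g, q2 = 1%g & q3 = 1%g]].

Definition pseudo_exponent_values (R : realType) (gT : finGroupType)
    (G : {group gT}) : set R :=
  [set a : R | exists n m p : nat,
    [/\ [/\ (0 < n)%N, (0 < m)%N & (0 < p)%N],
        ~ [/\ n = 1%N, m = 1%N & p = 1%N],
        realizes G n m p &
        a = 3 * ln (#|G|%:R) / ln ((n * m * p)%N%:R)]].

Arguments pseudo_exponent_values R {gT} G.

(* The infimum is a minimum, see [pseudo_exponent_min]. *)
Definition pseudo_exponent (R : realType) (gT : finGroupType) (G : {group gT}) : R :=
  if #|G| == 1%N then 3 else inf (pseudo_exponent_values R G).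

Arguments pseudo_exponent R {gT} G.

Definition irreducible_degree (R : realType) (gT : finGroupType)
    (G : {group gT}) (d : nat) : Prop :=
  exists rG : mx_representation R[i] G d, mx_irreducible rG.

Arguments irreducible_degree R {gT} G d.

(* Irreducible representations of [G] have dimension at most [#|G|], see
   [irreducible_degree_le_max]. *)
Definition max_degree (R : realType) (gT : finGroupType) (G : {group gT}) : nat :=
  (\max_(d < #|G|.+1 | `[< irreducible_degree R G d >]) d)%N.

Arguments max_degree R {gT} G.

(* The solution of [#|G| `^ gamma^-1 = max_degree R G], see [powR_gammaV]. *)
Definition gamma (R : realType) (gT : finGroupType) (G : {group gT}) : \bar R :=
  if abelian G then +oo%E
  else (ln (#|G|%:R) / ln ((max_degree R G)%:R))%:E.

Arguments gamma R {gT} G.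

(* Straight-line programs multiplying two n x n matrices over a field F.
   [Result k] is the value computed by the k-th instruction (counted from 0). *)
Inductive operand (F : Type) (n : nat) : Type :=
| LeftEntry of 'I_n & 'I_n
| RightEntry of 'I_n & 'I_n
| Const of F
| Result of nat.

Inductive arith_op : Type := OpAdd | OpSub | OpMul | OpDiv.

Definition instruction (F : Type) (n : nat) : Type :=
  (arith_op * operand F n * operand F n)%type.

(* A reference to a result not computed yet reads as the constant 0, which is
   also available as [Const 0]. *)
Definition fetch (F : fieldType) (n : nat) (A B : 'M[F]_n) (mem : seq F)
    (a : operand F n) : F :=
  match a with
  | LeftEntry i j => A i j
  | RightEntry i j => B i j
  | Const c => c
  | Result k => mem`_k
  end.

Definition arith (F : fieldType) (op : arith_op) (x y : F) : option F :=
  match op with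
  | OpAdd => Some (x + y)
  | OpSub => Some (x - y)
  | OpMul => Some (x * y)
  | OpDiv => if y == 0 then None else Some (x / y)
  end.

Fixpoint run (F : fieldType) (n : nat) (A B : 'M[F]_n)
    (prog : seq (instruction F n)) (mem : seq F) : option (seq F) :=
  match prog with
  | [::] => Some mem
  | (op, a, b) :: prog' =>
      if arith op (fetch A B mem a) (fetch A B mem b) is Some v
      then run A B prog' (rcons mem v) else None
  end.

(* On every input the program must run without division by zero. *)
Definition multiplies (F : fieldType) (n : nat) (prog : seq (instruction F n))
    (out : 'I_n -> 'I_n -> operand F n) : Prop :=
  forall A B : 'M[F]_n, exists2 mem : seq F,
    run A B prog [::] = Some mem &
    forall i j : 'I_n, fetch A B mem (out i j) = (A *m B) i j.

Definition matmul_in (F : fieldType) (n L : nat) : Prop :=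
  exists prog : seq (instruction F n), exists out : 'I_n -> 'I_n -> operand F n,
    multiplies prog out /\ size prog = L.

Arguments matmul_in F n L : clear implicits.

Definition matmul_bigO (R : realType) (t : R) : Prop :=
  exists2 ops : nat -> nat,
    forall n : nat, matmul_in R[i] n (ops n) &
    (fun n => (ops n)%:R : R^o) =O_\oo (fun n => n%:R `^ t : R^o).

Definition exponent_bounds (R : realType) : set R :=
  [set w : R | forall e : R, 0 < e -> matmul_bigO (w + e)].

Arguments exponent_bounds R : clear implicits.

(* The infimum is a minimum, see [matmul_exponent_min]. *)
Definition matmul_exponent (R : realType) : R := inf (exponent_bounds R).

Definition gamma_ratio (R : realType) (a : R) (g : \bar R) : R :=
  if g is r%:E then (r - 2) / (r - a) else 1.

Lemma pseudo_exponent_min (R : realType) (gT : finGroupType) (G : {group gT}) :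
  #|G| != 1%N ->
  pseudo_exponent_values R G (pseudo_exponent R G) /\
  lbound (pseudo_exponent_values R G) (pseudo_exponent R G).
Proof.
move=> G1; rewrite /pseudo_exponent (negPf G1).
set V := pseudo_exponent_values R G.
have V3 : V 3.
  exists #|G|, 1%N, 1%N; split; first by rewrite cardG_gt0.
  - by case=> /eqP; rewrite (negPf G1).
  - exists (G : {set gT}), 1%g, 1%g; split; first by rewrite !sub1G.
      by rewrite cards1.
    have q1 q : q \in quotients (1%g : {set gT}) -> q = 1%g.
      by case/imset2P => x y /set1P-> /set1P-> ->; rewrite mulgV.
    move=> q1' q2 q3 _ /q1 -> /q1 ->; rewrite !mulg1 => ->.
    by split.
  - rewrite !muln1 mulfK // gt_eqF // ln_gt0 // ltr1n ltn_neqAle eq_sym G1.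
    by rewrite cardG_gt0.
pose T := ('I_#|G|.+1 * 'I_#|G|.+1 * 'I_#|G|.+1)%type.
pose val (t : T) : R := 3 * ln (#|G|%:R) / ln ((t.1.1 * t.1.2 * t.2)%N%:R).
pose P (t : T) := `[< [/\ [/\ (0 < t.1.1)%N, (0 < t.1.2)%N & (0 < t.2)%N],
        ~ [/\ t.1.1 = 1%N :> nat, t.1.2 = 1%N :> nat & t.2 = 1%N :> nat] &
        realizes G t.1.1 t.1.2 t.2] >].
have VP a : V a -> exists2 t, P t & a = val t.
  case=> n [m [p [h1 h2 h3 ->]]].
  have [S1 [S2 [S3 [[s1 s2 s3] [c1 c2 c3] _]]]] := h3.
  have hn : (n < #|G|.+1)%N by rewrite ltnS -c1 subset_leq_card.
  have hm : (m < #|G|.+1)%N by rewrite ltnS -c2 subset_leq_card.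
  have hp : (p < #|G|.+1)%N by rewrite ltnS -c3 subset_leq_card.
  by exists (Ordinal hn, Ordinal hm, Ordinal hp) => //; apply/asboolP.
have PV t : P t -> V (val t).
  by move=> /asboolP[h1 h2 h3]; exists t.1.1, t.1.2, t.2.
have [t0 Pt0 _] := VP _ V3.
have [t Pt tmin] := arg_minP val Pt0.
have lb : lbound V (val t) by move=> a /VP[u Pu ->]; exact: tmin.
have -> : inf V = val t.
  apply/eqP; rewrite eq_le; apply/andP; split.
    by apply: ge_inf; [exists (val t) | exact: PV].
  by apply: lb_le_inf => //; exists 3.
by split=> //; exact: PV.
Qed.

Section MaxDegree.
Variables (R : realType) (gT : finGroupType) (G : {group gT}).
Let F := R[i].
Lemma pgroup_pchar_complex : ([pchar F]^'.-group G)%g.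
Proof. by apply/pgroupP => p _ _; apply/negPf; exact: pchar_num. Qed.

Lemma irreducible_degreeP (sG : irrType F G) d : irreducible_degree R G d ->
  exists i : sG, irr_degree i = d.
Proof.
case=> rG irr; exists (irr_comp sG rG).
have [f e _ _] := rsim_irr_comp_pchar sG pgroup_pchar_complex irr.
exact: esym e.
Qed.

Lemma irreducible_degree_lt (d : nat) : irreducible_degree R G d -> (d < #|G|.+1)%N.
Proof.
pose sG := DecSocleType (regular_repr F G).
move=> /(irreducible_degreeP sG)[i di].
rewrite ltnS -(sum_irr_degree_pchar sG pgroup_pchar_complex (@group_closure_closed_field _ _ G)).
rewrite (bigD1 i) //= di; apply: leq_trans (leq_addr _ _).
by case: (d) => // k; rewrite expnS expn1 leq_pmulr.
Qed.

Lemma irreducible_degree_le_max d :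
  irreducible_degree R G d -> (d <= max_degree R G)%N.
Proof.
move=> h; have hd := irreducible_degree_lt h.
by apply: (@leq_bigmax_cond _ _ _ (Ordinal hd)); apply/asboolP.
Qed.

Lemma irreducible_degree_irr (sG : irrType F G) (i : sG) :
  irreducible_degree R G (irr_degree i).
Proof. by exists (irr_repr i); exact: socle_irr. Qed.

Lemma irreducible_degree_max : irreducible_degree R G (max_degree R G).
Proof.
pose sG := DecSocleType (regular_repr F G).
have h := @irreducible_degree_irr sG (principal_comp sG).
pose P (d : 'I_#|G|.+1) := `[< irreducible_degree R G d >].
have [|d Pd e] := @eq_bigmax_cond _ P (@nat_of_ord _).
  by apply/card_gt0P; exists (Ordinal (irreducible_degree_lt h)); apply/asboolP.
by rewrite /max_degree e; apply/asboolP.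
Qed.

Lemma max_degree_gt1 : ~~ abelian G -> (1 < max_degree R G)%N.
Proof.
apply: contraNltn => le1.
pose sG := DecSocleType (regular_repr F G).
have splitG := @group_closure_closed_field F gT G.
have d1 (i : sG) : irr_degree i = 1%N.
  apply/eqP; rewrite eqn_leq irr_degree_gt0 andbT.
  by rewrite (leq_trans _ le1) ?irreducible_degree_le_max //; exact: irreducible_degree_irr.
have := card_linear_irr sG pgroup_pchar_complex splitG.
have -> : #|linear_irr sG| = #|G|.
  rewrite -(sum_irr_degree_pchar sG pgroup_pchar_complex splitG) -sum1_card.
  by apply: eq_big => i; rewrite ?inE d1.
have := Lagrange (der_sub 1 G) => <- /eqP; rewrite -[X in _ == X]mul1n.
rewrite eqn_pmul2r ?indexg_gt0 // => /eqP/card1_trivg H.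
by apply/derG1P.
Qed.

Lemma powR_gammaV : ~~ abelian G ->
  exists2 g : R, gamma R G = g%:E & #|G|%:R `^ g^-1 = (max_degree R G)%:R.
Proof.
move=> nab; exists (ln (#|G|%:R) / ln (max_degree R G)%:R).
  by rewrite /gamma (negPf nab).
have G1 : (1 < #|G|)%N.
  rewrite ltn_neqAle cardG_gt0 andbT eq_sym; apply: contraNneq nab => /card1_trivg ->.
  exact: abelian1.
have g0 : ln (#|G|%:R) != 0 :> R by rewrite gt_eqF // ln_gt0 // ltr1n.
rewrite /powR pnatr_eq0 eqn0Ngt cardG_gt0 /= invf_div.
rewrite divfK // lnK // posrE ltr0n.
exact: ltnW (max_degree_gt1 nab).
Qed.
End MaxDegree.

Section Programs.
Variables (F : fieldType) (n : nat).
Implicit Types (A B : 'M[F]_n) (p q : seq (instruction F n)) (mem : seq F).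

Lemma run_cat A B p q mem : run A B (p ++ q) mem =
  if run A B p mem is Some mem' then run A B q mem' else None.
Proof.
elim: p mem => [//|[[op a] b] p IHp] mem /=.
by case: arith => [v|//]; exact: IHp.
Qed.

Lemma dot_program (i j : 'I_n) (s : nat) (ks : seq 'I_n) :
  exists (p : seq (instruction F n)) (out : operand F n), size p = (2 * size ks)%N /\
  forall A B mem, size mem = s -> exists m1,
    [/\ run A B p mem = Some (mem ++ m1), size m1 = size p &
     forall m2, fetch A B ((mem ++ m1) ++ m2) out =
       \sum_(k <- ks) A i k * B k j].
Proof.
elim/last_ind: ks => [|ks k [p [out [sp IH]]]].
  exists [::], (Const _ 0); split=> // A B mem _; exists [::].
  by split=> //; [rewrite cats0 | move=> m2; rewrite big_nil].
exists (p ++ [:: (OpMul, LeftEntry _ i k, RightEntry _ k j);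
                 (OpAdd, out, Result _ _ (s + size p))]).
exists (Result _ _ (s + size p).+1); split.
  by rewrite size_cat sp size_rcons mulnS addnC.
move=> A B mem sm; have [m1 [r1 s1 f1]] := IH A B mem sm.
exists (m1 ++ [:: A i k * B k j; \sum_(k <- rcons ks k) A i k * B k j]); split.
- have := f1 [:: A i k * B k j]; rewrite run_cat r1 /= cats1 => ->.
  rewrite -!cats1 nth_cat size_cat sm s1 ltnn subnn /=.
  by rewrite -!catA /= big_cat /= big_seq1.
- by rewrite !size_cat s1.
- move=> m2; rewrite /= catA -catA nth_cat size_cat sm s1 ltnNge leqnSn /=.
  by rewrite subSn // subnn.
Qed.

Lemma matmul_cubic : matmul_in F n (2 * n * (n * n))%N.
Proof.
have [p [out [sp h]]] : exists (p : seq (instruction F n)) (out : 'I_n * 'I_n -> operand F n),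
  size p = (2 * n * size (enum {: 'I_n * 'I_n}))%N /\
  forall A B, exists mem, [/\ run A B p [::] = Some mem, size mem = size p &
    forall m x, x \in enum {: 'I_n * 'I_n} ->
      fetch A B (mem ++ m) (out x) = (A *m B) x.1 x.2].
  elim/last_ind: (enum _) => [|xs x [p [out [sp IH]]] ].
    by exists [::], (fun=> Const _ 0); split=> [|A B]; [rewrite muln0 | exists [::]].
  case: x => i j; have [q [res [sq hq]]] := dot_program i j (size p) (enum 'I_n).
  exists (p ++ q), (fun x => if x == (i, j) then res else out x); split.
    by rewrite size_cat sp sq size_rcons size_enum_ord mulnS addnC.
  move=> A B; have [mem [r s f]] := IH A B.
  have [m1 [r1 s1 f1]] := hq A B mem s.
  exists (mem ++ m1); split; first by rewrite run_cat r.
    by rewrite !size_cat s s1.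
  move=> m x; rewrite mem_rcons inE; case: eqP => [->|_] /= xin.
    by rewrite f1 mxE big_enum.
  by rewrite -catA f.
exists p, (fun i j => out (i, j)); split.
  move=> A B; have [mem [r s f]] := h A B; exists mem => // i j.
  by rewrite -[mem]cats0 f // mem_enum.
by rewrite sp -cardE card_prod card_ord.
Qed.
End Programs.

Lemma matmul_in_gt0 (F : numFieldType) (n L : nat) :
  (0 < n)%N -> matmul_in F n L -> (0 < L)%N.
Proof.
case: n => // n _ [p [out [mul <-]]]; case: p mul => // mul.
have prodE a b : (a%:M *m b%:M : 'M[F]_n.+1) ord0 ord0 = a * b.
  by rewrite -scalar_mxM mxE eqxx.
have h a b : fetch a%:M b%:M [::] (out ord0 ord0) = a * b :> F.
  by rewrite -prodE; have [_ [<-]] := mul a%:M b%:M.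
case: (out _ _) h => [i j|i j|c|k] h.
- have := h 2 2; rewrite /= mxE -natrM; case: eqP => _ /eqP.
    by rewrite mulr1n eqr_nat.
  by rewrite mulr0n eq_sym pnatr_eq0.
- have := h 2 2; rewrite /= mxE -natrM; case: eqP => _ /eqP.
    by rewrite mulr1n eqr_nat.
  by rewrite mulr0n eq_sym pnatr_eq0.
- have /= e1 := h 1 2; have /= e2 := h 2 2.
  have /eqP : 2 = (2 * 2)%:R :> F by rewrite natrM -e2 e1 mul1r.
  by rewrite eqr_nat.
- by have := h 1 1; rewrite /= nth_nil mulr1 => /eqP; rewrite eq_sym oner_eq0.
Qed.

Lemma matmul_bigO_mono (R : realType) (t u : R) :
  t <= u -> matmul_bigO t -> matmul_bigO u.
Proof.
move=> tu [ops h /eqO_exP[k k0 O]]; exists ops => //; apply/eqO_exP; exists k => //.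
apply: filterS2 (nbhs_infty_gt 0%N) O => x x0 /le_trans; apply.
rewrite (ler_wpM2l (ltW k0)) // !ger0_norm ?powR_ge0 //.
by apply: ler_powR => //; rewrite ler1n.
Qed.

Lemma matmul_bigO_ge0 (R : realType) (t : R) : matmul_bigO t -> 0 <= t.
Proof.
move=> [ops h /eqO_exP[k k0 Ok]]; rewrite leNgt; apply/negP => t0.
suff [n n0 lt1] : exists2 n, (0 < n)%N & (ops n)%:R < 1 :> R.
  by have := matmul_in_gt0 n0 (h n); move: lt1; rewrite ltrn1 ltnS leqn0 => /eqP ->.
near \oo => n.
have n0 : (0 < n)%N by near: n; exact: nbhs_infty_gt.
exists n => //.
have : `|(ops n)%:R : R^o| <= k * `|n%:R `^ t : R^o| by near: n.
rewrite !ger0_norm ?powR_ge0 // => /le_lt_trans; apply.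
rewrite -[t]opprK powRN -ltr_pdivlMr ?invr_gt0 ?powR_gt0 ?ltr0n // invrK mul1r.
have nt0 : 0 < - t by rewrite oppr_gt0.
have -> : k = (k `^ (- t)^-1) `^ (- t).
  by rewrite -powRrM mulVf ?gt_eqF // powRr1 // ltW.
rewrite gt0_ltr_powR ?nnegrE ?powR_ge0 ?ler0n //.
near: n; exact: nbhs_infty_gtr.
Unshelve. all: by end_near. Qed.

Lemma matmul_exponent_min (R : realType) :
  exponent_bounds R (matmul_exponent R) /\
  lbound (exponent_bounds R) (matmul_exponent R).
Proof.
have lb : has_lbound (exponent_bounds R).
  exists 0 => w hw; rewrite leNgt; apply/negP => w0.
  have /matmul_bigO_ge0 : matmul_bigO (w + (- w / 2)).
    by apply: hw; rewrite divr_gt0 // oppr_gt0.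
  have -> : w + - w / 2 = w / 2 by field.
  by rewrite leNgt ltr_pdivrMr // mul0r w0.
have b3 : exponent_bounds R 3.
  move=> e e0; apply: (@matmul_bigO_mono _ 3); first by rewrite lerDl ltW.
  exists (fun n => 2 * n * (n * n))%N; first by move=> n; exact: matmul_cubic.
  apply/eqO_exP; exists 2 => //; near=> n.
  rewrite !ger0_norm ?powR_ge0 // powR_mulrn // !natrM -mulrA.
  by rewrite (_ : n%:R * (n%:R * n%:R) = n%:R ^+ 3) ?ler_wpM2r // exprS expr2.
split; last by move=> w hw; apply: ge_inf.
move=> e e0.
have [|w hw lt] := @inf_adherent _ (exponent_bounds R) (e / 2) _ (conj (ex_intro _ _ b3) lb).
  by rewrite divr_gt0.
apply: (@matmul_bigO_mono _ (w + e / 2)); last by apply: hw; rewrite divr_gt0.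
by rewrite /matmul_exponent; move: lt; set x := inf _ => lt; lra.
Unshelve. all: by end_near. Qed.

(* Main.v *)
Require Import Defs.
From mathcomp Require Import all_boot all_order all_algebra all_fingroup.
From mathcomp Require Import all_character.
From mathcomp Require Import all_classical all_reals all_analysis.
From mathcomp Require Import complex mxtens ring lra zify.
Import Order.TTheory GRing.Theory Num.Theory.
Import numFieldNormedType.Exports.
Local Open Scope ring_scope.

Set Implicit Arguments.
Unset Strict Implicit.
Unset Printing Implicit Defensive.

(* If [G] realizes <n,m,p>, then n x m, m x p and p x n matrices embed into the
   group algebra so that the trilinear form tr(ABC) becomes the coefficient of 1
   in a product of three elements. That coefficient is the regular character
   divided by [#|G|], so tr(ABC) is a sum over the irreducible representations,
   of degrees d_i, of traces of products of three d_i x d_i matrices.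
   Symmetrizing over the rotations of (n,m,p) and taking k-th tensor powers, the
   rank of multiplication of size N^k with N = nmp is at most
   C (sum_i d_i^w)^(3k) for every w > omega. Letting k tend to infinity yields
   N^omega <= (sum_i d_i^w)^3 when omega > 2, and
   sum_i d_i^w <= dmax^(w-2) #|G|. When omega <= 2 the bound follows from
   alpha >= 2, which holds because nm, mp and pn are at most #|G|. *)

(** * From programs to rank *)

(** Rank at most [r] of the tensor of n x n matrix multiplication. Every linear form on matrices is
    a trace against a fixed matrix, so a triple of matrices encodes a product of three linear forms;
    zero terms may pad the list. *)
Definition mmrank (F : fieldType) (n r : nat) : Prop :=
  exists2 s : seq ('M[F]_n * 'M[F]_n * 'M[F]_n), size s = r &
    forall A B C : 'M[F]_n, \tr (A *m B *m C) =
      \sum_(t <- s) \tr (t.1.1 *m A) * \tr (t.1.2 *m B) * \tr (t.2 *m C).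

Lemma mxtrace_delta_mul (F : fieldType) (m n : nat) (A : 'M[F]_(m, n)) i j :
  \tr (delta_mx j i *m A) = A i j.
Proof.
rewrite /mxtrace (bigD1 j) //= big1 ?addr0 => [|k kj].
  rewrite mxE (bigD1 i) //= big1 ?addr0 => [|l li]; first by rewrite mxE !eqxx mul1r.
  by rewrite mxE (negPf li) andbF mul0r.
by rewrite mxE big1 // => l _; rewrite mxE (negPf kj) mul0r.
Qed.

Section RankFromProgram.
Variables (F : closedFieldType) (n : nat).
Hypothesis F_char0 : forall k : nat, k.+1%:R != 0 :> F.

Implicit Types (A B : 'M[F]_n) (f g : 'M[F]_n -> 'M[F]_n -> F).

Definition linear_form (l : 'M[F]_n * 'M[F]_n) A B : F :=
  \tr (l.1 *m A) + \tr (l.2 *m B).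

(** The weights are indexed by [nat] so that they keep their meaning when [ps] grows; only those
    below [size ps] count. *)
Definition product_span (ps : seq (('M[F]_n * 'M[F]_n) * ('M[F]_n * 'M[F]_n)))
    (w : nat -> F) A B : F :=
  \sum_(k < size ps) w k * (linear_form (nth ((0, 0), (0, 0)) ps k).1 A B *
                            linear_form (nth ((0, 0), (0, 0)) ps k).2 A B).

(* Along every line [t |-> (t A, t B)], [f] is a polynomial in [t] whose
   coefficient at [t^1] is one linear form in (A, B), and whose coefficient at
   [t^2] is one combination of the products [ps]. *)
Definition quadratic_jet ps f : Prop :=
  exists (c : F) l w, forall A B, exists p : {poly F},
    [/\ forall t, f (t *: A) (t *: B) = p.[t], p`_0 = c,
        p`_1 = linear_form l A B & p`_2 = product_span ps w A B].

Lemma linear_formD a b (l l' : 'M[F]_n * 'M[F]_n) A B :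
  linear_form (a *: l.1 + b *: l'.1, a *: l.2 + b *: l'.2) A B =
  a * linear_form l A B + b * linear_form l' A B.
Proof.
by rewrite /linear_form /= !mulmxDl !mxtraceD -!scalemxAl !mxtraceZ; ring.
Qed.

Lemma product_spanD ps a b w w' A B :
  product_span ps (fun k => a * w k + b * w' k) A B =
  a * product_span ps w A B + b * product_span ps w' A B.
Proof.
by rewrite /product_span !mulr_sumr -big_split; apply: eq_bigr => k _ /=; ring.
Qed.

Lemma product_span_rcons ps l l' c w A B :
  product_span (rcons ps (l, l')) (fun k => if k == size ps then c else w k) A B =
  product_span ps w A B + c * (linear_form l A B * linear_form l' A B).
Proof.
rewrite /product_span size_rcons big_ord_recr /= eqxx nth_rcons ltnn eqxx /=.
congr (_ + _); apply: eq_bigr => k _.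
by rewrite nth_rcons ltn_ord ltn_eqF.
Qed.

Lemma quadratic_jet_rcons ps ll f :
  quadratic_jet ps f -> quadratic_jet (rcons ps ll) f.
Proof.
case: ll => l0 l1 [c [l [w h]]].
exists c, l, (fun k => if k == size ps then 0 else w k) => A B.
have [p [h1 h2 h3 h4]] := h A B; exists p; split=> //.
by rewrite product_span_rcons mul0r addr0.
Qed.

Lemma quadratic_jet_lin ps a b f g : quadratic_jet ps f -> quadratic_jet ps g ->
  quadratic_jet ps (fun A B => a * f A B + b * g A B).
Proof.
move=> [c [l [w hf]]] [c' [l' [w' hg]]].
exists (a * c + b * c'), (a *: l.1 + b *: l'.1, a *: l.2 + b *: l'.2).
exists (fun k => a * w k + b * w' k) => A B.
have [p [p0 p1 p2 p3]] := hf A B; have [q [q0 q1 q2 q3]] := hg A B.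
exists (a *: p + b *: q); split.
- by move=> t; rewrite p0 q0 hornerD !hornerZ.
- by rewrite coefD !coefZ p1 q1.
- by rewrite coefD !coefZ p2 q2 linear_formD.
- by rewrite coefD !coefZ p3 q3 product_spanD.
Qed.

Lemma quadratic_jet_cst ps c : quadratic_jet ps (fun _ _ => c).
Proof.
exists c, (0, 0), (fun=> 0) => A B; exists c%:P; split.
- by move=> t; rewrite hornerC.
- by rewrite coefC.
- by rewrite coefC /linear_form !mul0mx mxtrace0 addr0.
- by rewrite coefC /product_span big1 // => k _; rewrite mul0r.
Qed.

Lemma quadratic_jet_linear ps l : quadratic_jet ps (linear_form l).
Proof.
exists 0, l, (fun=> 0) => A B; exists (linear_form l A B *: 'X); split.
- move=> t; rewrite hornerZ hornerX /linear_form.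
  by rewrite -!scalemxAr !mxtraceZ; ring.
- by rewrite coefZ coefX mulr0.
- by rewrite coefZ coefX mulr1.
- by rewrite coefZ coefX mulr0 /product_span big1 // => k _; rewrite mul0r.
Qed.


(** The coefficient of t^2 in pq is p_0 q_2 + p_1 q_1 + p_2 q_0, where p_0 and q_0 are constants;
    only p_1 q_1 calls for a new product. *)
Lemma quadratic_jet_mul ps f g : quadratic_jet ps f -> quadratic_jet ps g ->
  exists ll, quadratic_jet (rcons ps ll) (fun A B => f A B * g A B).
Proof.
move=> [c [l [w hf]]] [c' [l' [w' hg]]]; exists (l, l').
exists (c * c'), (c' *: l.1 + c *: l'.1, c' *: l.2 + c *: l'.2).
exists (fun k => if k == size ps then 1 else c' * w k + c * w' k) => A B.
have [p [p0 p1 p2 p3]] := hf A B; have [q [q0 q1 q2 q3]] := hg A B.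
exists (p * q); split.
- by move=> t; rewrite p0 q0 hornerM.
- by rewrite coef0M p1 q1.
- by rewrite linear_formD coefM !big_ord_recr big_ord0 /= p1 q1 p2 q2; ring.
- rewrite product_span_rcons product_spanD coefM !big_ord_recr big_ord0 /=.
  by rewrite /subn /= p1 q1 p2 q2 p3 q3; ring.
Qed.

(* A polynomial in t without roots is constant, so a denominator that never
   vanishes is constant along every line through the origin. *)
Lemma quadratic_jet_div ps f g : quadratic_jet ps f -> quadratic_jet ps g ->
  (forall A B, g A B != 0) -> quadratic_jet ps (fun A B => f A B / g A B).
Proof.
move=> [c [l [w hf]]] [c' [l' [w' hg]]] g0.
have gc A B : g A B = c'.
  have [q [q0 q1 _ _]] := hg A B.
  have /size_poly1P[b _ qb] : size q == 1%N.
    apply: contraT => /closed_rootP[t /rootP qt].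
    by have := g0 (t *: A) (t *: B); rewrite q0 qt eqxx.
  by rewrite -[A]scale1r -[B]scale1r q0 -q1 qb hornerC coefC.
have jf : quadratic_jet ps f by exists c, l, w.
have [c2 [l2 [w2 h]]] := quadratic_jet_lin c'^-1 0 jf jf.
exists c2, l2, w2 => A B; have [p [p0 p1 p2 p3]] := h A B; exists p; split=> // t.
by rewrite -p0 gc mul0r addr0 mulrC.
Qed.

Lemma linear_form_left i j A B : linear_form (delta_mx j i, 0) A B = A i j.
Proof. by rewrite /linear_form mul0mx mxtrace0 addr0 mxtrace_delta_mul. Qed.

Lemma linear_form_right i j A B : linear_form (0, delta_mx j i) A B = B i j.
Proof. by rewrite /linear_form mul0mx mxtrace0 add0r mxtrace_delta_mul. Qed.

Lemma quadratic_jet_ext ps f g :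
  (forall A B, f A B = g A B) -> quadratic_jet ps f -> quadratic_jet ps g.
Proof.
move=> fg [c [l [w h]]]; exists c, l, w => A B.
have [p [p0 p1 p2 p3]] := h A B; exists p; split=> // t.
by rewrite -fg.
Qed.

Lemma quadratic_jet_fetch ps (fs : seq ('M[F]_n -> 'M[F]_n -> F)) o :
  (forall k, (k < size fs)%N -> quadratic_jet ps (nth (fun _ _ => 0) fs k)) ->
  quadratic_jet ps (fun A B => fetch A B [seq f A B | f <- fs] o).
Proof.
move=> h; case: o => [i j|i j|c|k] /=.
- exact: quadratic_jet_ext (linear_form_left i j) (quadratic_jet_linear _ _).
- exact: quadratic_jet_ext (linear_form_right i j) (quadratic_jet_linear _ _).
- exact: quadratic_jet_cst.
- have [lt|le] := ltnP k (size fs).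
    apply: quadratic_jet_ext (h _ lt) => A B.
    by rewrite (nth_map (fun _ _ => 0)).
  apply: quadratic_jet_ext (quadratic_jet_cst ps 0) => A B.
  by rewrite nth_default // size_map.
Qed.

(** A program has no branching, so its memory is one list [fs] of functions of (A, B). Each
    instruction adds one function, and only a multiplication adds a product to [ps]. *)
Lemma quadratic_jet_run (prog : seq (instruction F n)) ps fs :
  (forall k, (k < size fs)%N -> quadratic_jet ps (nth (fun _ _ => 0) fs k)) ->
  (forall A B, run A B prog [seq f A B | f <- fs] != None) ->
  exists ps' fs', [/\ (size ps' <= size ps + size prog)%N,
    forall k, (k < size fs')%N -> quadratic_jet ps' (nth (fun _ _ => 0) fs' k) &
    forall A B, run A B prog [seq f A B | f <- fs] = Some [seq f A B | f <- fs']].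
Proof.
elim: prog ps fs => [|[[op a] b] prog IH] ps fs hfs defd.
  by exists ps, fs; split; rewrite ?addn0.
pose fa A B := fetch A B [seq f A B | f <- fs] a.
pose fb A B := fetch A B [seq f A B | f <- fs] b.
have ja : quadratic_jet ps fa by exact: quadratic_jet_fetch.
have jb : quadratic_jet ps fb by exact: quadratic_jet_fetch.
suff [ps1 [v [sp hps1 jv vE]]] : exists ps1 v, [/\ (size ps1 <= (size ps).+1)%N,
    forall f, quadratic_jet ps f -> quadratic_jet ps1 f, quadratic_jet ps1 v &
    forall A B, arith op (fa A B) (fb A B) = Some (v A B)].
  have runE A B : run A B ((op, a, b) :: prog) [seq f A B | f <- fs] =
      run A B prog [seq f A B | f <- rcons fs v].
    by rewrite /= -/(fa A B) -/(fb A B) vE map_rcons.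
  have [k|A B|ps' [fs' [s1 s2 s3]]] := IH ps1 (rcons fs v).
  - rewrite size_rcons ltnS leq_eqVlt nth_rcons => /orP[/eqP ->|lt].
      by rewrite ltnn eqxx.
    by rewrite lt; apply: hps1; exact: hfs.
  - by rewrite -runE.
  - exists ps', fs'; split=> //; last by move=> A B; rewrite runE.
    by rewrite (leq_trans s1) //= addnS -addSn leq_add2r.
have {IH}defd1 A B : arith op (fa A B) (fb A B) != None.
  by have := defd A B; rewrite /= -/(fa A B) -/(fb A B); case: arith.
case: op defd defd1 => /= defd defd1.
- exists ps, (fun A B => fa A B + fb A B); split=> //.
  by apply: quadratic_jet_ext (quadratic_jet_lin 1 1 ja jb) => A B; rewrite !mul1r.
- exists ps, (fun A B => fa A B - fb A B); split=> //.
  apply: quadratic_jet_ext (quadratic_jet_lin 1 (-1) ja jb) => A B.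
  by rewrite mul1r mulN1r.
- have [ll jll] := quadratic_jet_mul ja jb.
  exists (rcons ps ll), (fun A B => fa A B * fb A B); split=> //.
    by rewrite size_rcons.
  by move=> f; exact: quadratic_jet_rcons.
(* The program is defined on every input, so this denominator never vanishes. *)
- have fb0 A B : fb A B != 0.
    by apply: contraNneq (defd1 A B) => ->; rewrite eqxx.
  exists ps, (fun A B => fa A B / fb A B); split=> //; first exact: quadratic_jet_div.
  by move=> A B; rewrite (negPf (fb0 A B)).
Qed.

(** In characteristic 0 the images of 0, 1, 2, ... are distinct, which gives p - q more roots than
    its degree allows. *)
Lemma poly_eq_horner (p q : {poly F}) : (forall t, p.[t] = q.[t]) -> p = q.
Proof.
move=> pq; apply/eqP; rewrite -subr_eq0; apply/eqP.
pose rs := [seq k%:R : F | k <- iota 0 (size (p - q))].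
apply: (@roots_geq_poly_eq0 _ _ rs); last by rewrite size_map size_iota.
  by apply/allP => t _; rewrite rootE hornerD hornerN pq subrr.
rewrite map_inj_uniq ?iota_uniq //.
have inj i j : (i <= j)%N -> i%:R = j%:R :> F -> i = j.
  move=> ij /eqP; rewrite eq_sym -subr_eq0 -natrB //.
  case E: (j - i)%N => [|k]; last by rewrite (negPf (F_char0 k)).
  by move=> _; apply/eqP; rewrite eqn_leq ij -subn_eq0 E.
move=> i j; case/orP: (leq_total i j) => h; first exact: inj.
by move=> /esym/(inj _ _ h).
Qed.

(* Since [A *m B] is bilinear, only the products of a linear form in [A] with a
   linear form in [B] contribute; each of the L products gives two of them. *)
Lemma mmrank_of_program L : matmul_in F n L ->
  exists2 r, (r <= 2 * L)%N & mmrank F n r.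
Proof.
case=> prog [out [mul <-]].
have [//|A B|ps [fs [sp jfs runE]]] := @quadratic_jet_run prog [::] [::].
  by have [mem -> _] := mul A B.
have [w wE] : exists w : 'I_n -> 'I_n -> nat -> F, forall i j A B,
    (A *m B) i j = product_span ps (w i j) A B.
  have jet i j : exists w, forall A B, (A *m B) i j = product_span ps w A B.
    have [c [l [w h]]] := quadratic_jet_fetch (out i j) jfs.
    exists w => A B; have [p [p0 _ _ <-]] := h A B.
    (* Along the line through (A, B) the entry is [(A *m B) i j] times t^2, so the second
       coefficient of the jet is the entry itself. *)
    suff -> : p = (A *m B) i j *: 'X^2 by rewrite coefZ coefXn mulr1.
    apply: poly_eq_horner => t; rewrite -p0 hornerZ hornerXn.
    have [mem] := mul (t *: A) (t *: B).
    rewrite runE => -[<-] ->.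
    by rewrite -scalemxAl -scalemxAr scalerA mxE mulrC.
  have [w' hw'] := choice (fun ij => jet ij.1 ij.2).
  by exists (fun i j => w' (i, j)) => i j; exact: hw' (i, j).
pose d0 : 'M[F]_n * 'M[F]_n * ('M[F]_n * 'M[F]_n) := ((0, 0), (0, 0)).
pose W (k : nat) : 'M[F]_n := \matrix_(i, j) w i j k.
pose s1 := [seq ((nth d0 ps k).1.1, (nth d0 ps k).2.2, W k)
            | k <- index_iota 0 (size ps)].
pose s2 := [seq ((nth d0 ps k).2.1, (nth d0 ps k).1.2, W k)
            | k <- index_iota 0 (size ps)].
exists (size (s1 ++ s2)).
  by rewrite size_cat !size_map size_iota subn0 addnn -mul2n leq_mul2l.
exists (s1 ++ s2) => // A B C.
have trE i j : (A *m B) i j = \sum_(k < size ps) w i j k *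
    (\tr ((nth d0 ps k).1.1 *m A) * \tr ((nth d0 ps k).2.2 *m B) +
     \tr ((nth d0 ps k).2.1 *m A) * \tr ((nth d0 ps k).1.2 *m B)).
  (* Subtracting the values at (A, 0) and (0, B) removes the products of two forms in the same
     matrix. *)
  have e0 : (A *m B) i j = (A *m B) i j - (A *m 0) i j - (0 *m B) i j.
    by rewrite mulmx0 mul0mx [(0 : 'M[F]_n) i j]mxE !subr0.
  rewrite e0 !wE /product_span -!sumrB; apply: eq_bigr => k _.
  by rewrite /linear_form !mulmx0 mxtrace0; ring.
rewrite big_cat !big_map !(big_mkord xpredT) /= -big_split /=.
transitivity (\sum_i \sum_j (A *m B) i j * C j i).
  by apply: eq_bigr => i _; rewrite mxE.
have WE k : \tr (W k *m C) = \sum_i \sum_j w i j k * C j i.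
  rewrite /mxtrace; apply: eq_bigr => i _; rewrite mxE.
  by apply: eq_bigr => j _; rewrite mxE.
transitivity (\sum_i \sum_j \sum_(k < size ps) w i j k *
    (\tr ((nth d0 ps k).1.1 *m A) * \tr ((nth d0 ps k).2.2 *m B) +
     \tr ((nth d0 ps k).2.1 *m A) * \tr ((nth d0 ps k).1.2 *m B)) * C j i).
  by apply: eq_bigr => i _; apply: eq_bigr => j _; rewrite trE mulr_suml.
rewrite pair_bigA exchange_big; apply: eq_bigr => k _ /=.
rewrite WE pair_bigA /= -mulrDl.
move: (_ + _) => tAB; rewrite mulr_sumr; apply: eq_bigr => ij _ /=; ring.
Qed.

End RankFromProgram.

(** * From rank to programs *)

Section Computation.
Variables (F : fieldType) (n : nat).
Local Notation entry := ('M[F]_n -> 'M[F]_n -> F).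
Implicit Types (fs : seq entry) (f g : entry).

Definition computed fs : Prop :=
  exists2 p : seq (instruction F n), size p = size fs &
    forall A B, run A B p [::] = Some [seq f A B | f <- fs].

(** Quantifying over the later memory [mem] makes availability survive any extension of the
    program. *)
Definition available fs f : Prop :=
  exists o, forall A B mem, fetch A B ([seq g A B | g <- fs] ++ mem) o = f A B.

Definition extends (c : nat) fs fs' : Prop :=
  computed fs' /\ exists2 gs, (size gs <= c)%N & fs' = fs ++ gs.

Lemma extends_refl fs : computed fs -> extends 0 fs fs.
Proof. by move=> h; split=> //; exists [::]; rewrite ?cats0. Qed.

Lemma extends_trans c d fs1 fs2 fs3 :
  extends c fs1 fs2 -> extends d fs2 fs3 -> extends (c + d) fs1 fs3.
Proof.
move=> [_ [gs1 s1 ->]] [h3 [gs2 s2 e]]; split=> //; exists (gs1 ++ gs2).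
  by rewrite size_cat leq_add.
by rewrite e catA.
Qed.

Lemma extends_leq c d fs fs' : (c <= d)%N -> extends c fs fs' -> extends d fs fs'.
Proof.
by move=> le_cd [h [gs s e]]; split=> //; exists gs => //; exact: leq_trans le_cd.
Qed.

Lemma available_extends c fs fs' f :
  extends c fs fs' -> available fs f -> available fs' f.
Proof.
move=> [_ [gs _ ->]] [ o h]; exists o => A B mem.
by rewrite map_cat -catA h.
Qed.

Lemma available_ext fs f g :
  (forall A B, f A B = g A B) -> available fs f -> available fs g.
Proof. by move=> fg [ o h]; exists o => A B mem; rewrite h fg. Qed.

Lemma available_cst fs c : available fs (fun _ _ => c).
Proof. by exists (Const _ c). Qed.

Lemma available_left fs i j : available fs (fun A _ => A i j).
Proof. by exists (LeftEntry _ i j). Qed.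

Lemma available_right fs i j : available fs (fun _ B => B i j).
Proof. by exists (RightEntry _ i j). Qed.

Lemma available_op op f g h fs :
  (forall A B, arith op (f A B) (g A B) = Some (h A B)) ->
  computed fs -> available fs f -> available fs g ->
  exists2 fs', extends 1 fs fs' & available fs' h.
Proof.
move=> opE [p sp pE] [ o oE] [ o' oE']; exists (rcons fs h).
  split; last by exists [:: h]; rewrite ?cats1.
  exists (rcons p (op, o, o')); first by rewrite !size_rcons sp.
  move=> A B; rewrite -cats1 run_cat pE /= -[map _ _]cats0 oE oE' opE.
  by rewrite cats0 map_rcons.
exists (Result _ _ (size fs)) => A B mem /=.
by rewrite map_rcons cat_rcons nth_cat size_map ltnn subnn.
Qed.

Lemma available_dot (I : Type) (s : seq I) (f g : I -> entry) fs :
  computed fs -> (forall i, available fs (f i)) -> (forall i, available fs (g i)) ->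
  exists2 fs', extends (2 * size s) fs fs' &
    available fs' (fun A B => \sum_(i <- s) f i A B * g i A B).
Proof.
move=> cfs hf hg; elim: s => [|i s [fs1 e1 a1]].
  exists fs; first exact: extends_refl.
  by apply: available_ext (available_cst _ 0) => A B; rewrite big_nil.
have [||||fs2 e2 a2] := @available_op OpMul (f i) (g i) (fun A B => f i A B * g i A B) fs1.
- by [].
- by case: e1.
- exact: available_extends e1 (hf i).
- exact: available_extends e1 (hg i).
have [||fs3 e3 a3] := @available_op OpAdd (fun A B => f i A B * g i A B) _
    (fun A B => \sum_(i <- i :: s) f i A B * g i A B) fs2 _ _ a2 (available_extends e2 a1).
- by move=> A B; rewrite /= big_cons.
- by case: e2.
exists fs3 => //; apply: extends_leq (extends_trans (extends_trans e1 e2) e3).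
by rewrite /= mulnS; lia.
Qed.

(** The step is assumed from every extension of [fs], since the other elements of [ys] have already
    enlarged the memory. One step may deliver a whole family indexed by [Z], at joint cost [c]. *)
Lemma available_all (Y : eqType) (Z : Type) (ys : seq Y) (g : Y -> Z -> entry) c fs :
  computed fs ->
  (forall d fs' y, extends d fs fs' ->
     exists2 fs'', extends c fs' fs'' & forall z, available fs'' (g y z)) ->
  exists2 fs', extends (size ys * c) fs fs' &
    forall y z, y \in ys -> available fs' (g y z).
Proof.
move=> cfs step; elim: ys => [|y ys [fs1 e1 a1]].
  by exists fs; first exact: extends_refl.
have [fs2 e2 a2] := step _ _ y e1; exists fs2.
  by rewrite /= mulSn addnC; exact: extends_trans e1 e2.
move=> y' z; rewrite inE => /orP[/eqP -> //|/a1 h].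
exact: available_extends e2 (h z).
Qed.

(** The factors are arbitrary available functions of the inputs, so that the bound applies to the
    smaller products inside a recursion. Indexing by a finite type turns block indices into plain
    pairs. *)
Definition product_cost (X : finType) (c : nat) : Prop :=
  forall fs (a b : X -> X -> entry), computed fs ->
    (forall x y, available fs (a x y)) -> (forall x y, available fs (b x y)) ->
  exists2 fs', extends c fs fs' &
    forall x y, available fs' (fun A B => \sum_z a x z A B * b z y A B).

Lemma product_cost_unit : product_cost unit 2.
Proof.
move=> fs a b cfs ha hb.
have [fs' e h] := available_dot (fintype.enum {: unit}) cfs (ha tt) (hb^~ tt).
exists fs'; first by rewrite -cardE card_unit in e.
by move=> [] []; apply: available_ext h => A B; rewrite big_enum.
Qed.

Lemma mxtrace_mulE (N : nat) (T : 'M[F]_N) (M : 'I_N -> 'I_N -> F) :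
  \tr (T *m \matrix_(i, j) M i j) = \sum_(ij : 'I_N * 'I_N) T ij.2 ij.1 * M ij.1 ij.2.
Proof.
rewrite -(pair_bigA _ (fun i j => T j i * M i j)) exchange_big; apply: eq_bigr => j _.
by rewrite mxE; apply: eq_bigr => i _; rewrite mxE.
Qed.

(** One level of Strassen's recursion: the linear forms of the rank decomposition yield [r] pairs of
    matrices indexed by [X], which are multiplied at cost [c] each. Computing the forms in [a],
    those in [b], and recombining take 2 r N^2 #|X|^2 operations each, whence the 6. *)
Lemma product_cost_block (X : finType) (N r c : nat) :
  mmrank F N r -> product_cost X c ->
  product_cost ('I_N * X)%type (r * c + 6 * (r * N ^ 2) * #|X| ^ 2).
Proof.
move=> [s sr sE] cX fs a b cfs ha hb.
pose T k := nth (0, 0, 0) s k.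
have linear_forms fs0 (m : 'I_r -> 'M[F]_N) (e : 'I_N * X -> 'I_N * X -> entry) :
    computed fs0 -> (forall x y, available fs0 (e x y)) ->
    exists2 fs', extends (2 * (r * N ^ 2) * #|X| ^ 2) fs0 fs' & forall k x x',
      available fs' (fun A B => \tr (m k *m \matrix_(i, j) e (i, x) (j, x') A B)).
  move=> cfs0 he.
  have [|fs' e' h] := @available_all _ unit (fintype.enum {: 'I_r * X * X})
    (fun u _ A B => \tr (m u.1.1 *m \matrix_(i, j) e (i, u.1.2) (j, u.2) A B))
    (2 * N ^ 2) fs0 cfs0.
    move=> d fs1 [[k x] x'] e1 /=.
    have [||| fs2 e2 h2] := @available_dot _ (fintype.enum {: 'I_N * 'I_N})
       (fun ij _ _ => m k ij.2 ij.1) (fun ij => e (ij.1, x) (ij.2, x')) fs1.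
    - by case: e1.
    - by move=> ij; exact: available_cst.
    - by move=> ij; exact: available_extends e1 (he _ _).
    exists fs2.
      by rewrite -cardE card_prod card_ord in e2.
    by move=> _; apply: available_ext h2 => A B; rewrite mxtrace_mulE big_enum.
  exists fs'; last by move=> k x x'; apply: (h (k, x, x') tt); rewrite mem_enum.
  by apply: extends_leq e'; rewrite -cardE !card_prod card_ord; lia.
have [fs1 e1 h1] := linear_forms fs (fun k => (T k).1.1) a cfs ha.
have [||fs2 e2 h2] := linear_forms fs1 (fun k => (T k).1.2) b.
- by case: e1.
- by move=> x y; exact: available_extends e1 (hb _ _).
pose LA (k : 'I_r) x x' A B := \tr ((T k).1.1 *m \matrix_(i, j) a (i, x) (j, x') A B).
pose LB (k : 'I_r) x x' A B := \tr ((T k).1.2 *m \matrix_(i, j) b (i, x) (j, x') A B).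
pose P (k : 'I_r) (x : X * X) A B := \sum_z LA k x.1 z A B * LB k z x.2 A B.
have [||fs3 e3 h3] := @available_all _ _ (fintype.enum 'I_r) P c fs2.
- by case: e2.
- move=> d fs' k e'.
  have [|||fs'' e'' h''] := cX fs' (LA k) (LB k).
  + by case: e'.
  + by move=> x y; apply: available_extends e' _; exact: available_extends e2 (h1 _ _ _).
  + by move=> x y; exact: available_extends e' (h2 _ _ _).
  by exists fs'' => // -[x y]; exact: h''.
have [||fs4 e4 h4] := @available_all _ unit (fintype.enum {: ('I_N * X) * ('I_N * X)})
  (fun u _ A B => \sum_(k < r) P k (u.1.2, u.2.2) A B * (T k).2 u.1.1 u.2.1) (2 * r) fs3.
- by case: e3.
- move=> d fs' [[i x] [j x']] e' /=.
  have [|||fs'' e'' h''] := @available_dot _ (fintype.enum 'I_r)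
    (fun k => P k (x, x')) (fun k _ _ => (T k).2 i j) fs'.
  + by case: e'.
  + by move=> k; apply: available_extends e' _; apply: h3; rewrite mem_enum.
  + by move=> k; exact: available_cst.
  exists fs''; first by rewrite -cardE card_ord in e''.
  by move=> _; apply: available_ext h'' => A B; rewrite big_enum.
exists fs4.
  apply: extends_leq (extends_trans (extends_trans e1 e2) (extends_trans e3 e4)).
  by rewrite -!cardE !card_prod !card_ord; nia.
move=> [i x] [j x']; have := h4 ((i, x), (j, x')) tt; rewrite mem_enum => /(_ isT).
apply: available_ext => A B /=.
pose blk (e : 'I_N * X -> 'I_N * X -> entry) y y' : 'M[F]_N :=
  \matrix_(i, j) e (i, y) (j, y') A B.
transitivity (\sum_z (blk a x z *m blk b z x') i j); last first.
  rewrite [RHS](eq_bigr (fun u => a (i, x) (u.1, u.2) A B * b (u.1, u.2) (j, x') A B)).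
    2: by case.
  rewrite -(pair_bigA _ (fun k z => a (i, x) (k, z) A B * b (k, z) (j, x') A B)) exchange_big.
  by apply: eq_bigr => z _; rewrite mxE; apply: eq_bigr => k _; rewrite !mxE.
transitivity (\sum_z \sum_(k < r) LA k x z A B * LB k z x' A B * (T k).2 i j).
  by rewrite exchange_big; apply: eq_bigr => k _; rewrite mulr_suml.
apply: eq_bigr => z _.
(* The entry (i, j) of a product is its trace against [delta_mx j i], taken as third argument of the
   decomposition; the third form then evaluates to [(T k).2 i j]. *)
rewrite -(mxtrace_delta_mul _ i j) mxtrace_mulC sE (big_nth (0, 0, 0)) sr big_mkord.
by apply: eq_bigr => k _; rewrite [\tr (_ *m delta_mx _ _)]mxtrace_mulC mxtrace_delta_mul.
Qed.

(* The term in [(N ^ k) ^ 2] absorbs the additions of the block recursion, because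
   [N ^ 2 < rho]. *)
Lemma product_cost_power (N r rho k : nat) :
  mmrank F N r -> (r <= rho)%N -> (N ^ 2 < rho)%N ->
  exists (X : finType) (c : nat), [/\ #|X| = (N ^ k)%N, product_cost X c &
    (c + 6 * (r * N ^ 2) * (N ^ k) ^ 2 <= (6 * (r * N ^ 2) + 2) * rho ^ k)%N].
Proof.
move=> rk rrho Nrho; elim: k => [|k [X [c [cardX cX le]]]].
  exists unit, 2%N; split; [by rewrite card_unit | exact: product_cost_unit |].
  by rewrite !expn0 exp1n !muln1 addnC.
exists ('I_N * X)%type, (r * c + 6 * (r * N ^ 2) * #|X| ^ 2)%N; split.
- by rewrite card_prod card_ord cardX expnS.
- exact: product_cost_block.
set K := (6 * (r * N ^ 2))%N in le *.
rewrite cardX !(expnS _ k) expnMn.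
have -> : ((K + 2) * (rho * rho ^ k) = rho * ((K + 2) * rho ^ k))%N by rewrite mulnCA.
apply: leq_trans (leq_mul (leqnn rho) le).
rewrite mulnDr -addnA leq_add ?leq_mul //.
move: ((N ^ k) ^ 2)%N (N ^ 2)%N Nrho => M S Srho.
have : (K * M * S.+1 <= K * M * rho)%N by rewrite leq_mul.
by lia.
Qed.

(** The injection [h] places n x n matrices inside matrices indexed by [X]; indices outside its
    image only meet the zero padding. *)
Lemma matmul_in_of_cost (X : finType) c :
  (n <= #|X|)%N -> product_cost X c -> exists2 L, (L <= c)%N & matmul_in F n L.
Proof.
move=> nX cX.
pose h (i : 'I_n) : X := enum_val (widen_ord nX i).
have h_inj : injective h.
  by move=> i j /enum_val_inj/(congr1 val) e; exact: val_inj.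
pose pad (e : 'I_n -> 'I_n -> entry) x y : entry :=
  if [pick i | h i == x] is Some i then
    if [pick j | h j == y] is Some j then e i j else fun _ _ => 0
  else fun _ _ => 0.
have pick_h i : [pick j | h j == h i] = Some i.
  by case: pickP => [j /eqP/h_inj -> //|/(_ i)]; rewrite eqxx.
have padE e i j : pad e (h i) (h j) = e i j by rewrite /pad !pick_h.
have pad_avail e : (forall i j, available [::] (e i j)) ->
    forall x y, available [::] (pad e x y).
  move=> he x y; rewrite /pad; case: pickP => [i _|_]; last exact: available_cst.
  by case: pickP => [j _|_]; [exact: he | exact: available_cst].
have [|||fs [[p sp pE] [gs sgs fsE]] hfs] :=
  cX [::] (pad (fun i j A _ => A i j)) (pad (fun i j _ B => B i j)).
- by exists [::].
- by apply: pad_avail => i j; exact: available_left.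
- by apply: pad_avail => i j; exact: available_right.
have [out outE] := choice (fun ij : 'I_n * 'I_n => hfs (h ij.1) (h ij.2)).
exists (size p); first by rewrite sp fsE.
exists p, (fun i j => out (i, j)); split=> // A B.
exists [seq f A B | f <- fs] => // i j.
have := outE (i, j) A B [::]; rewrite cats0 => -> /=.
rewrite mxE (bigID [in codom h]) /= [X in _ + X]big1 ?addr0 => [|z hz]; last first.
  rewrite /pad; case: pickP => [i' _|_]; last by rewrite mul0r.
  case: pickP => [k /eqP hk|_]; last by rewrite mul0r.
  by rewrite -hk codom_f in hz.
rewrite -big_uniq /=; last by rewrite map_inj_uniq ?fintype.enum_uniq.
by rewrite big_image; apply: eq_bigr => k _; rewrite !padE.
Qed.

End Computation.

(** * Reduction of matrix multiplication to direct sums *)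

Lemma mxtrace_tens (R : comPzRingType) (m n : nat) (A : 'M[R]_m) (B : 'M[R]_n) :
  \tr (A *t B) = \tr A * \tr B.
Proof.
rewrite /mxtrace mulr_sum; apply: eq_bigr => k _.
by case: (mxtens_indexP k) => i j; rewrite mxtens_indexK tensmxE.
Qed.

Section Reduction.
Variable F : fieldType.

(* The matrix multiplication tensor <n,m,p> is a restriction of the direct sum
   of the tensors <d i, d i, d i>. *)
Definition mm_reduces (n m p : nat) (D : finType) (d : D -> nat) : Prop :=
  exists (a : 'I_n -> 'I_m -> forall i, 'M[F]_(d i))
         (b : 'I_m -> 'I_p -> forall i, 'M[F]_(d i))
         (c : 'I_p -> 'I_n -> forall i, 'M[F]_(d i)),
  forall x x' y y' z z',
    \sum_i \tr (a x y i *m b y' z i *m c z' x' i) =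
    ((x == x') && (y == y') && (z == z'))%:R.

Lemma mm_reduces_rot n m p (D : finType) (d : D -> nat) :
  mm_reduces n m p d -> mm_reduces m p n d.
Proof.
move=> [a [b [c h]]]; exists b, c, a => y y' z z' x x'.
transitivity (\sum_i \tr (a x' y' i *m b y z i *m c z' x i)).
  by apply: eq_bigr => i _; rewrite mxtrace_mulC mulmxA.
rewrite h; congr (nat_of_bool _)%:R.
by rewrite (eq_sym x') (eq_sym y'); case: (x == x'); rewrite ?andbF ?andbT.
Qed.

Lemma mm_reduces1 : mm_reduces 1 1 1 (fun _ : unit => 1%N).
Proof.
exists (fun _ _ _ => 1), (fun _ _ _ => 1), (fun _ _ _ => 1) => x x' y y' z z'.
by rewrite !ord1 (big_pred1 tt) ?mul1mx ?mxtrace1 //; case.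
Qed.

(** Kronecker products of the embeddings work because the trace is multiplicative, so the sum over
    pairs factors. *)
Lemma mm_reduces_tens n m p n' m' p' (D D' : finType) (d : D -> nat) (d' : D' -> nat) :
  mm_reduces n m p d -> mm_reduces n' m' p' d' ->
  mm_reduces (n * n') (m * m') (p * p') (fun i : D * D' => (d i.1 * d' i.2)%N).
Proof.
move=> [a [b [c h]]] [a' [b' [c' h']]].
pose u1 m n (k : 'I_(m * n)) := (mxtens_unindex k).1.
pose u2 m n (k : 'I_(m * n)) := (mxtens_unindex k).2.
exists (fun x y i => a (u1 _ _ x) (u1 _ _ y) i.1 *t a' (u2 _ _ x) (u2 _ _ y) i.2).
exists (fun x y i => b (u1 _ _ x) (u1 _ _ y) i.1 *t b' (u2 _ _ x) (u2 _ _ y) i.2).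
exists (fun x y i => c (u1 _ _ x) (u1 _ _ y) i.1 *t c' (u2 _ _ x) (u2 _ _ y) i.2).
move=> x x' y y' z z'.
have eqE k l (s t : 'I_(k * l)) : (s == t) = (u1 _ _ s == u1 _ _ t) && (u2 _ _ s == u2 _ _ t).
  by rewrite -(inj_eq (can_inj (@mxtens_unindexK k l))) -pair_eqE.
transitivity (\sum_i \sum_j
    \tr (a (u1 _ _ x) (u1 _ _ y) i *m b (u1 _ _ y') (u1 _ _ z) i *m
         c (u1 _ _ z') (u1 _ _ x') i) *
    \tr (a' (u2 _ _ x) (u2 _ _ y) j *m b' (u2 _ _ y') (u2 _ _ z) j *m
         c' (u2 _ _ z') (u2 _ _ x') j)).
  rewrite pair_bigA; apply: eq_bigr => -[i j] _ /=.
  by rewrite !tensmx_mul mxtrace_tens.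
under eq_bigr => i _ do rewrite -mulr_sumr h'.
rewrite -mulr_suml h -natrM mulnb; congr (nat_of_bool _)%:R.
by rewrite !eqE; do !case: (_ == _).
Qed.

(** [push] maps n x n matrices linearly into block [i], and [pull] is its adjoint for the trace
    pairing. Pulling back the decompositions of all blocks decomposes tr(ABC). *)
Lemma mmrank_reduces n (D : finType) (d r : D -> nat) :
  mm_reduces n n n d -> (forall i, mmrank F (d i) (r i)) ->
  mmrank F n (\sum_i r i)%N.
Proof.
move=> [a [b [c h]]] rk.
pose s i := s2val (cid2 (rk i)).
have size_s i : size (s i) = r i by exact: (s2valP (cid2 (rk i))).
have sE i (A B C : 'M[F]_(d i)) : \tr (A *m B *m C) =
    \sum_(t <- s i) \tr (t.1.1 *m A) * \tr (t.1.2 *m B) * \tr (t.2 *m C).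
  exact: (s2valP' (cid2 (rk i))).
pose pull i (e : 'I_n -> 'I_n -> forall i, 'M[F]_(d i)) (T : 'M[F]_(d i)) : 'M[F]_n :=
  \matrix_(y, x) \tr (T *m e x y i).
pose push i (e : 'I_n -> 'I_n -> forall i, 'M[F]_(d i)) (A : 'M[F]_n) :=
  \sum_x \sum_y A x y *: e x y i.
have pullE i e T A : \tr (pull i e T *m A) = \tr (T *m push i e A).
  rewrite /push /mxtrace -/(mxtrace (T *m _)) mulmx_sumr raddf_sum /=.
  transitivity (\sum_y \sum_x A x y * \tr (T *m e x y i)).
    apply: eq_bigr => y _; rewrite mxE; apply: eq_bigr => x _.
    by rewrite mxE mulrC.
  rewrite exchange_big; apply: eq_bigr => x _ /=.
  rewrite mulmx_sumr raddf_sum; apply: eq_bigr => y _ /=.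
  by rewrite -scalemxAr mxtraceZ.
exists (flatten [seq [seq (pull i a t.1.1, pull i b t.1.2, pull i c t.2) | t <- s i]
                | i <- index_enum D]).
  rewrite size_flatten sumnE !big_map.
  by apply: eq_bigr => i _; rewrite size_map size_s.
move=> A B C.
rewrite big_flatten big_map /=.
transitivity (\sum_i \tr (push i a A *m push i b B *m push i c C)); last first.
  apply: eq_bigr => i _; rewrite sE big_map.
  by apply: eq_bigr => t _; rewrite !pullE.
(* After expansion in entries, the deltas of the reduction keep exactly the terms
   [A x y * B y z * C z x]. *)
transitivity (\sum_x \sum_y \sum_z A x.1 x.2 * B y.1 y.2 * C z.1 z.2 *
    \sum_i \tr (a x.1 x.2 i *m b y.1 y.2 i *m c z.1 z.2 i)).
  under [RHS]eq_bigr => x _ do under eq_bigr => y _ do under eq_bigr => z _ do rewrite h.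
  transitivity (\sum_x \sum_y \sum_z A x y * B y z * C z x).
    rewrite /mxtrace; apply: eq_bigr => x _; rewrite mxE exchange_big /=.
    apply: eq_bigr => z _; rewrite mxE mulr_suml.
    by apply: eq_bigr.
  rewrite -(pair_bigA _ (fun x y => \sum_yz \sum_zx A x y * B yz.1 yz.2 * C zx.1 zx.2 *
     ((x == zx.2) && (y == yz.1) && (yz.2 == zx.1))%:R)) /=.
  apply: eq_bigr => x _; apply: eq_bigr => y _.
  rewrite -(pair_bigA _ (fun y' z => \sum_zx A x y * B y' z * C zx.1 zx.2 *
     ((x == zx.2) && (y == y') && (z == zx.1))%:R)) /=.
  rewrite [RHS](bigD1 y) //= [X in _ + X]big1 ?addr0 => [|y' ne]; last first.
    rewrite big1 // => z _; rewrite big1 // => zx _.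
    by rewrite [y == _]eq_sym (negPf ne) andbF mulr0.
  apply: eq_bigr => z _; rewrite [RHS](bigD1 (z, x)) //= !eqxx mulr1.
  rewrite [X in _ + X]big1 ?addr0 // => -[z' x'] ne.
  case: eqP => [xx|]; rewrite ?mulr0 //=; case: eqP => [zz|]; rewrite ?andbF ?mulr0 //.
  by move: ne; rewrite /= xx zz eqxx.
under eq_bigr => x _ do under eq_bigr => y _ do under eq_bigr => z _ do rewrite mulr_sumr.
under eq_bigr => x _ do under eq_bigr => y _ do rewrite exchange_big /=.
under eq_bigr => x _ do rewrite exchange_big /=.
rewrite exchange_big /=; apply: eq_bigr => i _.
have pushE e A' : push i e A' = \sum_x A' x.1 x.2 *: e x.1 x.2 i.
  by rewrite /push pair_bigA.
rewrite !pushE -mulmxA mulmx_suml raddf_sum; apply: eq_bigr => x _ /=.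
rewrite mulmx_suml mulmx_sumr raddf_sum; apply: eq_bigr => y _ /=.
rewrite !mulmx_sumr raddf_sum; apply: eq_bigr => z _ /=.
by rewrite -!scalemxAr -!scalemxAl -!scalemxAr !mxtraceZ mulmxA; ring.
Qed.

End Reduction.

(** * Matrix multiplication inside the group algebra *)

Section GroupReduction.
Variables (R : realType) (gT : finGroupType) (G : {group gT}).
Let F : closedFieldType := R[i].

Lemma mxtrace_regular_repr (K : fieldType) g : g \in G ->
  \tr (regular_repr K G g) = #|G|%:R *+ (g == 1%g).
Proof.
move=> Gg; case: eqP => [->|/eqP g1]; first by rewrite repr_mx1 mxtrace1.
rewrite mulr0n /mxtrace big1 // => i _; rewrite !mxE /=.
rewrite -(inj_eq enum_val_inj) /= gring_indexK ?groupM ?enum_valP //.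
by rewrite -{1}[enum_val i]mulg1 (can_eq (mulKg _)) eq_sym (negPf g1).
Qed.

(** The regular representation contains each irreducible one as often as its degree, and its
    character is #|G| at 1 and 0 elsewhere. *)
Lemma irr_trace_indicator (sG : irrType F G) g : g \in G ->
  \sum_(i : sG) (irr_degree i)%:R / #|G|%:R * \tr (irr_repr i g) = (g == 1%g)%:R.
Proof.
move=> Gg; have G0 : #|G|%:R != 0 :> F by rewrite pnatr_eq0 -lt0n cardG_gt0.
apply: (mulfI G0); rewrite mulr_natr -(mxtrace_regular_repr F Gg).
rewrite (mxtrace_regular_pchar sG (pgroup_pchar_complex R G)
  (@group_closure_closed_field F gT G) Gg) mulr_sumr.
apply: eq_bigr => i _; rewrite -[RHS]mulr_natl mulrA; congr (_ * _).
by rewrite mulrC divfK.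
Qed.

Lemma mem_quotients (S : {set gT}) x y :
  x \in S -> y \in S -> (x * y^-1)%g \in quotients S.
Proof. by move=> Sx Sy; apply/imset2P; exists x y. Qed.

(** The matrix unit at (x, y) is sent to x^-1 y, seen in each irreducible representation. The factor
    d_i / #|G|, which turns traces into the coefficient of 1, is put on the first embedding. *)
Lemma realizes_mm_reduces (sG : irrType F G) n m p : realizes G n m p ->
  mm_reduces F n m p (fun i : sG => irr_degree i).
Proof.
move=> [S1 [S2 [S3 [[G1 G2 G3] [<- <- <-] TPP]]]].
exists (fun x y i => ((irr_degree i)%:R / #|G|%:R) *:
          irr_repr i ((enum_val x)^-1 * enum_val y)%g).
exists (fun y z i => irr_repr i ((enum_val y)^-1 * enum_val z)%g).
exists (fun z x i => irr_repr i ((enum_val z)^-1 * enum_val x)%g) => x x' y y' z z'.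
have Gx (u : 'I_#|S1|) : enum_val u \in G by rewrite (fintype.subsetP G1) ?enum_valP.
have Gy (u : 'I_#|S2|) : enum_val u \in G by rewrite (fintype.subsetP G2) ?enum_valP.
have Gz (u : 'I_#|S3|) : enum_val u \in G by rewrite (fintype.subsetP G3) ?enum_valP.
(* The product x^-1 y y'^-1 z z'^-1 x' is conjugate to q1 q2 q3, which by the triple product
   property is 1 only when x = x', y = y' and z = z'. *)
pose q1 := (enum_val x' * (enum_val x)^-1)%g.
pose q2 := (enum_val y * (enum_val y')^-1)%g.
pose q3 := (enum_val z * (enum_val z')^-1)%g.
pose g := (q1 * q2 * q3)%g.
have gJ : ((enum_val x)^-1 * enum_val y * ((enum_val y')^-1 * enum_val z) *
   ((enum_val z')^-1 * enum_val x') = g ^ enum_val x')%g.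
  by rewrite /g /q1 /q2 /q3 conjgE !mulgA mulVg mul1g.
transitivity (\sum_(i : sG) (irr_degree i)%:R / #|G|%:R * \tr (irr_repr i (g ^ enum_val x')%g)).
  apply: eq_bigr => i _; rewrite -!scalemxAl mxtraceZ -gJ.
  by rewrite [in RHS]repr_mxM ?groupM ?groupV // [in RHS]repr_mxM ?groupM ?groupV.
rewrite irr_trace_indicator ?groupJ ?groupM ?groupV // conjg_eq1.
congr (nat_of_bool _)%:R; apply/eqP/andP => [g1|[/andP[/eqP xx /eqP yy] /eqP zz]].
  have [||| e1 e2 e3] := TPP q1 q2 q3 _ _ _ g1; rewrite ?mem_quotients ?enum_valP //.
  have inj (S : {set gT}) (u v : 'I_#|S|) : (enum_val u * (enum_val v)^-1 = 1)%g -> u == v.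
    by move=> /eqP; rewrite -eq_mulgV1 (inj_eq enum_val_inj).
  by rewrite (eq_sym x) !inj.
by rewrite /g /q1 /q2 /q3 xx yy zz !mulgV !mulg1.
Qed.

Lemma realizes_rot n m p : realizes G n m p -> realizes G m p n.
Proof.
move=> [S1 [S2 [S3 [[G1 G2 G3] [c1 c2 c3] TPP]]]]; exists S2, S3, S1; split=> //.
move=> q2 q3 q1 h2 h3 h1 e; have [] := TPP _ _ _ h1 h2 h3; last by split.
have -> : (q1 * q2 * q3 = (q2 * q3 * q1) ^ q1^-1)%g by rewrite conjgE invgK !mulgA mulgK.
by rewrite e conj1g.
Qed.

(** Taking q3 = 1 in the triple product property makes (x, y) |-> x^-1 y injective on S1 x S2;
    [0 < p] puts 1 among the quotients of S3. *)
Lemma realizes_leq_card n m p : (0 < p)%N -> realizes G n m p -> (n * m <= #|G|)%N.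
Proof.
move=> p0 [S1 [S2 [S3 [[G1 G2 _] [<- <- c3] TPP]]]].
have [s S3s] : exists s, s \in S3 by apply/card_gt0P; rewrite c3.
rewrite -cardsX -(card_in_imset (f := fun u : gT * gT => (u.1^-1 * u.2)%g)).
  apply/subset_leq_card/fintype.subsetP => _ /imsetP[[x y] /setXP[/= S1x S2y] ->].
  rewrite groupM ?groupV //; first exact: (fintype.subsetP G1).
  exact: (fintype.subsetP G2).
move=> [x y] [x' y'] /setXP[/= S1x S2y] /setXP[/= S1x' S2y'] /= e.
have := TPP (x' * x^-1)%g (y * y'^-1)%g (s * s^-1)%g.
case; rewrite ?mem_quotients //.
  by rewrite mulgV mulg1 -mulgA (mulgA x^-1%g) e !mulgA mulgV mul1g mulgV.
by move=> /eqP; rewrite -eq_mulgV1 => /eqP-> /eqP; rewrite -eq_mulgV1 => /eqP->.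
Qed.

End GroupReduction.

(** * The exponent and the pseudo-exponent *)

Lemma matmul_exponent_le (R : realType) (t : R) : matmul_bigO t -> matmul_exponent R <= t.
Proof.
move=> h; apply: (matmul_exponent_min R).2 => e e0.
by apply: matmul_bigO_mono h; rewrite lerDl ltW.
Qed.

(** Strassen's bound. Size n is padded to N^(k+1), where N^k <= n, and rho^k = (N^k)^t <= n^t; the
    remaining factor rho goes into the constant. *)
Lemma matmul_bigO_of_mmrank (R : realType) (N r rho : nat) :
  (1 < N)%N -> mmrank R[i] N r -> (r <= rho)%N -> (N ^ 2 < rho)%N ->
  matmul_bigO (ln rho%:R / ln N%:R : R).
Proof.
move=> N1 rk rrho Nrho; set t := _ / _.
pose K := (6 * (r * N ^ 2) + 2)%N.
have rho0 : (0 < rho)%N by exact: leq_trans Nrho.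
have bound n : exists L, matmul_in R[i] n L /\
    (L <= K * rho ^ (trunc_log N n).+1)%N.
  have [X [c [cardX cX le]]] := product_cost_power n (trunc_log N n).+1 rk rrho Nrho.
  have [|L Lc h] := @matmul_in_of_cost _ n X c _ cX.
    by rewrite cardX ltnW // trunc_log_ltn.
  by exists L; split=> //; apply: leq_trans Lc (leq_trans _ le); rewrite leq_addr.
have [ops hops] := choice bound; exists ops; first by move=> n; exact: (hops n).1.
apply/eqO_exP; exists (K * rho)%:R; first by rewrite ltr0n muln_gt0 /K addnS.
have lnN : 0 < ln N%:R :> R by rewrite ln_gt0 // ltr1n.
near=> n.
have n0 : (0 < n)%N by near: n; exact: nbhs_infty_gt.
rewrite !ger0_norm ?powR_ge0 //.
have le1 : (ops n)%:R <= (K * rho)%:R * rho%:R ^+ trunc_log N n :> R.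
  by rewrite -natrX -natrM ler_nat -mulnA -expnS (hops n).2.
apply: le_trans le1 _; rewrite ler_wpM2l ?ler0n //.
have rhoE : rho%:R = N%:R `^ t :> R.
  rewrite /t /powR pnatr_eq0 (gtn_eqF (ltnW N1)) divfK ?gt_eqF // lnK //.
  by rewrite posrE ltr0n.
rewrite rhoE -powR_mulrn ?powR_ge0 // -powRrM mulrC powRrM powR_mulrn ?ler0n //.
have t0 : 0 <= t by rewrite divr_ge0 ?ln_ge0 // ler1n // ltnW.
apply: ge0_ler_powR; rewrite ?nnegrE ?exprn_ge0 ?ler0n //.
by rewrite -natrX ler_nat; have /andP[] := trunc_log_bounds N1 n0.
Unshelve. all: by end_near. Qed.

(** Makes the asymptotic bound uniform: finitely many small sizes are absorbed in [C] because d^w >=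
    1 for d >= 1, and size 0 has rank 0. The factor 2 in [C] comes from [mmrank_of_program]. *)
Lemma mmrank_of_matmul_bigO (R : realType) (w : R) : matmul_bigO w ->
  exists2 C : R, 0 < C & forall d, exists2 r, mmrank R[i] d r & r%:R <= C * d%:R `^ w.
Proof.
move=> hw; have w0 := matmul_bigO_ge0 hw; case: hw => ops hops /eqO_exP[c c0 [n0 _ hc]].
have char0 k : k.+1%:R != 0 :> R[i] by rewrite pnatr_eq0.
exists (2 * (c + \sum_(i < n0) (ops i)%:R)).
  by rewrite mulr_gt0 // ltr_wpDr // sumr_ge0.
case=> [|d].
  exists 0; last by rewrite mulr_ge0 ?powR_ge0 // mulr_ge0 // addr_ge0 ?sumr_ge0 // ltW.
  by exists [::] => // A B C; rewrite big_nil [A]flatmx0 !mul0mx mxtrace0.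
have [r rL rk] := mmrank_of_program char0 (hops d.+1); exists r => //.
have le2 : r%:R <= 2 * (ops d.+1)%:R :> R by rewrite -natrM ler_nat.
apply: le_trans le2 _; rewrite -mulrA ler_wpM2l //.
have p1 : 1 <= d.+1%:R `^ w :> R.
  by rewrite -[leLHS](powRr0 d.+1%:R); apply: ler_powR => //; rewrite ler1n.
have S0 : 0 <= \sum_(i < n0) (ops i)%:R :> R by rewrite sumr_ge0.
have [ge|lt] := leqP n0 d.+1.
  have := hc _ ge; rewrite /= !ger0_norm ?powR_ge0 // => /le_trans; apply.
  by rewrite ler_wpM2r ?powR_ge0 // lerDl.
have leS : (ops d.+1)%:R <= \sum_(i < n0) (ops i)%:R :> R.
  by rewrite (bigD1 (Ordinal lt)) //= lerDl sumr_ge0.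
apply: le_trans leS _; apply: (@le_trans _ _ (c + \sum_(i < n0) (ops i)%:R)).
  by rewrite lerDr ltW.
by rewrite ler_peMr // addr_ge0 // ltW.
Qed.

(** * Sums of powers of degrees under rotations and tensor products *)

Section DegreeSums.
Variables (F : fieldType) (R : realType) (w : R).

(** Hides the blocks and keeps only the sum of the w-th powers of their sizes, which is
    multiplicative under tensor products. *)
Definition degree_reduces (n m p : nat) (s : R) : Prop :=
  exists (D : finType) (d : D -> nat),
    mm_reduces F n m p d /\ s = \sum_i (d i)%:R `^ w.

Lemma degree_reduces_rot n m p s : degree_reduces n m p s -> degree_reduces m p n s.
Proof. by case=> D [d [h ->]]; exists D, d; split=> //; exact: mm_reduces_rot. Qed.

Lemma degree_reduces_tens n m p s n' m' p' s' :
  degree_reduces n m p s -> degree_reduces n' m' p' s' ->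
  degree_reduces (n * n') (m * m') (p * p') (s * s').
Proof.
case=> D [d [h ->]] [D' [d' [h' ->]]].
exists (D * D')%type, (fun i => (d i.1 * d' i.2)%N); split; first exact: mm_reduces_tens.
rewrite mulr_suml -(pair_bigA _ (fun i j => (d i * d' j)%:R `^ w)) /=.
apply: eq_bigr => i _; rewrite mulr_sumr; apply: eq_bigr => j _.
by rewrite natrM powRM ?ler0n.
Qed.

(** The three rotations of <n,m,p> share the same [s], and their tensor product is square. *)
Lemma degree_reduces_sym n m p s : degree_reduces n m p s ->
  degree_reduces (n * m * p) (n * m * p) (n * m * p) (s ^+ 3).
Proof.
move=> h1; have h2 := degree_reduces_rot h1; have h3 := degree_reduces_rot h2.
have := degree_reduces_tens (degree_reduces_tens h1 h2) h3.
have -> : (m * p * n = n * m * p)%N by rewrite mulnC mulnA.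
have -> : (p * n * m = n * m * p)%N by rewrite -mulnA mulnC.
by rewrite exprS expr2 mulrA.
Qed.

Lemma degree_reduces_exp n s k :
  degree_reduces n n n s -> degree_reduces (n ^ k) (n ^ k) (n ^ k) (s ^+ k).
Proof.
move=> h; elim: k => [|k IH]; last by rewrite expnS exprS; exact: degree_reduces_tens.
exists unit, (fun=> 1%N); split; first exact: mm_reduces1.
by rewrite expr0 (big_pred1 tt) ?powR1 //; case.
Qed.

Lemma mmrank_degree_reduces n s C : degree_reduces n n n s ->
  (forall d, exists2 r, mmrank F d r & r%:R <= C * d%:R `^ w) ->
  exists2 r, mmrank F n r & r%:R <= C * s.
Proof.
case=> D [d [h ->]] rk.
have rk' k : exists r, mmrank F k r /\ r%:R <= C * k%:R `^ w.
  by have [r] := rk k; exists r.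
have [r hr] := choice rk'.
exists (\sum_i r (d i))%N.
  by apply: mmrank_reduces h _ => i; exact: (hr _).1.
by rewrite natr_sum mulr_sumr; apply: ler_sum => i _; exact: (hr _).2.
Qed.

End DegreeSums.

(** Tensor power trick: size N^k has rank at most C s^k, so om k ln N <= ln (C + 2) + k ln sg, and
    the constant fades as k grows. *)
Lemma matmul_exponent_degree_sum (R : realType) (w s : R) (N : nat) :
  (1 < N)%N -> matmul_bigO w -> degree_reduces R[i] w N N N s ->
  2 < matmul_exponent R -> matmul_exponent R * ln N%:R <= ln s.
Proof.
move=> N1 hw red om2; set om := matmul_exponent R in om2 *.
have [C C0 hC] := mmrank_of_matmul_bigO hw.
have lnN : 0 < ln N%:R :> R by rewrite ln_gt0 // ltr1n.
(* The recursion needs a rank bound above the square of the size, hence the maximum with N^2. *)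
pose sg := Num.max s (N%:R ^+ 2).
have sg1 : 1 <= sg by rewrite le_max exprn_ege1 ?orbT // ler1n ltnW.
have sg0 : 0 < sg by exact: lt_le_trans sg1.
have C2 : 0 < C + 2 by rewrite addr_gt0.
have s0 : 0 <= s.
  by case: red => D [d [_ ->]]; rewrite sumr_ge0 // => i _; exact: powR_ge0.
have bound k : (0 < k)%N -> k%:R * (om * ln N%:R - ln sg) <= ln (C + 2).
  move=> k0.
  have [r rk rle] := mmrank_degree_reduces (degree_reduces_exp k red) hC.
  (* The second summand forces rho > (N^k)^2; it is at most 2 sg^k, whence the constant C + 2. *)
  pose rho := (r + ((N ^ k) ^ 2).+1)%N.
  have Nk1 : (1 < N ^ k)%N by rewrite -{1}(exp1n k) ltn_exp2r.
  have := matmul_bigO_of_mmrank Nk1 rk (leq_addr _ _ : (r <= rho)%N) (leq_addl _ _).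
  move=> /matmul_exponent_le; rewrite -/om.
  have lnNk : ln (N ^ k)%:R = k%:R * ln N%:R :> R.
    by rewrite natrX lnXn ?ltr0n ?(ltnW N1) // mulr_natl.
  have k0R : 0 < k%:R :> R by rewrite ltr0n.
  rewrite lnNk ler_pdivlMr ?mulr_gt0 // => h.
  have rhole : rho%:R <= (C + 2) * sg ^+ k.
    have sk1 : 1 <= sg ^+ k by exact: exprn_ege1.
    have e1 : s ^+ k <= sg ^+ k by rewrite lerXn2r ?nnegrE ?(le_trans s0) // le_max lexx.
    have e2 : (((N ^ k) ^ 2)%N)%:R <= sg ^+ k.
      rewrite -expnM mulnC expnM !natrX lerXn2r ?nnegrE ?exprn_ge0 ?ler0n //.
        by rewrite (le_trans ler01).
      by rewrite le_max lexx orbT.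
    rewrite /rho natrD -addn1 natrD.
    have := ler_wpM2l (ltW C0) e1; lra.
  have : ln rho%:R <= ln ((C + 2) * sg ^+ k).
    have rho0 : 0 < rho%:R :> R by rewrite ltr0n /rho addnS.
    by rewrite ler_ln ?posrE // mulr_gt0 ?exprn_gt0.
  rewrite lnM ?posrE ?exprn_gt0 // lnXn // -[_ *+ k]mulr_natl => h'.
  by rewrite mulrBr lerBlDr mulrCA (le_trans h h').
have key : om * ln N%:R <= ln sg.
  rewrite leNgt -subr_gt0; apply/negP => x0.
  set x := _ - _ in x0 bound.
  pose k := (Num.bound `|ln (C + 2) / x|).+1.
  have := bound k isT; rewrite leNgt -ltr_pdivrMr // => /negP; apply.
  apply: le_lt_trans (ler_norm _) _; apply: lt_trans (archi_boundP _) _ => //.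
  by rewrite ltr_nat /k.
(* If the maximum were N^2, [key] would give om <= 2. *)
move: key; rewrite /sg /Num.max; case: ifP => // _.
rewrite lnXn ?ltr0n ?(ltnW N1) // -[_ *+ 2]mulr_natl ler_pM2r // => h.
by move: om2; rewrite ltNge h.
Qed.

(** Settles the trivial group, whose pseudo-exponent is 3. *)
Lemma matmul_exponent_le3 (R : realType) : matmul_exponent R <= 3.
Proof.
apply: matmul_exponent_le; exists (fun n => 2 * n * (n * n))%N.
  by move=> n; exact: matmul_cubic.
apply/eqO_exP; exists 2 => //; near=> n.
rewrite !ger0_norm ?powR_ge0 // powR_mulrn // !natrM.
by rewrite !exprS expr0 mulr1 !mulrA.
Unshelve. all: by end_near. Qed.

(** * Character degrees, the pseudo-exponent and the final inequality *)

Section PseudoExponent.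
Variables (R : realType) (gT : finGroupType) (G : {group gT}).
Let om := matmul_exponent R.
Let dmax := max_degree R G.

Lemma max_degree_gt0 : (0 < dmax)%N.
Proof.
pose sG := DecSocleType (regular_repr R[i] G).
apply: leq_trans (irr_degree_gt0 (principal_comp sG)) _.
exact: irreducible_degree_le_max (irreducible_degree_irr _).
Qed.

(** Each term satisfies d^w = d^(w-2) d^2 <= dmax^(w-2) d^2, and the squares of the degrees sum to
    #|G|. *)
Lemma sum_irr_degree_powR_le (sG : irrType R[i] G) (w : R) : 2 <= w ->
  0 < \sum_(i : sG) (irr_degree i)%:R `^ w <= dmax%:R `^ (w - 2) * #|G|%:R.
Proof.
move=> w2; apply/andP; split.
  rewrite (bigD1 (principal_comp sG)) //= ltr_pwDl //.
    by rewrite powR_gt0 // ltr0n irr_degree_gt0.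
  by rewrite sumr_ge0 // => i _; exact: powR_ge0.
rewrite -(sum_irr_degree_pchar sG (pgroup_pchar_complex R G)
  (@group_closure_closed_field R[i] gT G)) natr_sum mulr_sumr.
apply: ler_sum => i _; rewrite natrX -powR_mulrn ?ler0n //.
have -> : (irr_degree i)%:R `^ w = (irr_degree i)%:R `^ (w - 2) * (irr_degree i)%:R `^ 2.
  rewrite -powRD ?subrK //.
  by apply/implyP => _; rewrite pnatr_eq0 -lt0n; exact: irr_degree_gt0.
rewrite ler_wpM2r ?powR_ge0 // ge0_ler_powR ?nnegrE ?ler0n ?subr_ge0 //.
by rewrite ler_nat irreducible_degree_le_max //; exact: irreducible_degree_irr.
Qed.

Lemma realizes_matmul_exponent n m p : realizes G n m p -> (1 < n * m * p)%N ->
  2 < om -> om * ln (n * m * p)%N%:R <= 3 * ((om - 2) * ln dmax%:R + ln #|G|%:R).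
Proof.
move=> rG N1 om2; apply/ler_addgt0Pr => e e0.
have lnd0 : 0 <= ln dmax%:R :> R by rewrite ln_ge0 // ler1n max_degree_gt0.
(* Complexity bounds are at hand only for exponents above om, so w = om + eps is used, with 3 eps ln
   dmax <= e; the + 1 covers dmax = 1. *)
pose eps := e / (3 * ln dmax%:R + 1).
have eps0 : 0 < eps by rewrite divr_gt0 // ltr_wpDl // mulr_ge0.
pose sG := DecSocleType (regular_repr R[i] G).
pose w := om + eps.
have w2 : 2 <= w by rewrite ltW // ltr_wpDr // ltW.
have hw : matmul_bigO w by exact: (matmul_exponent_min R).1.
have red : degree_reduces R[i] w n m p (\sum_(i : sG) (irr_degree i)%:R `^ w).
  exists sG, (fun i : sG => irr_degree i); split=> //.
  exact: (realizes_mm_reduces sG rG).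
have /andP[s0 sle] := sum_irr_degree_powR_le sG w2.
apply: le_trans (matmul_exponent_degree_sum N1 hw (degree_reduces_sym red) om2) _.
rewrite lnXn // -[_ *+ 3]mulr_natl.
have d0 : 0 < dmax%:R :> R by rewrite ltr0n max_degree_gt0.
have : ln (\sum_(i : sG) (irr_degree i)%:R `^ w) <= (w - 2) * ln dmax%:R + ln #|G|%:R.
  have G0 : 0 < #|G|%:R :> R by rewrite ltr0n cardG_gt0.
  rewrite -ln_powR -lnM ?posrE ?powR_gt0 // ler_ln ?posrE //.
  by rewrite mulr_gt0 ?powR_gt0.
have : 3 * eps * ln dmax%:R <= e.
  rewrite -mulrA mulrCA /eps mulrAC ler_pdivrMr ?ltr_wpDl ?mulr_ge0 //.
  by rewrite (ler_wpM2l (ltW e0)) // lerDl.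
by rewrite /w; lra.
Qed.

(** The triple is one attaining the minimum. Multiplying the bounds of nm, mp and pn by #|G| gives
    the squared inequality, from which alpha >= 2 follows. *)
Lemma pseudo_exponent_realized : (1 < #|G|)%N -> exists n m p,
  [/\ realizes G n m p, (1 < n * m * p)%N, ((n * m * p) ^ 2 <= #|G| ^ 3)%N &
      pseudo_exponent R G * ln (n * m * p)%N%:R = 3 * ln #|G|%:R].
Proof.
move=> G1; have [|[n [m [p [[n0 m0 p0] ne rG ->]]]] _] := @pseudo_exponent_min R _ G.
  by rewrite gtn_eqF.
have N1 : (1 < n * m * p)%N.
  rewrite ltnNge; apply/negP; case: n m p n0 m0 p0 ne {rG} => [//|n] [//|m] [//|p] _ _ _ ne.
  by move=> le1; apply: ne; split; nia.
exists n, m, p; split=> //.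
  have -> : ((n * m * p) ^ 2 = (n * m) * (m * p) * (p * n))%N by lia.
  rewrite expnS -mulnn [leqRHS]mulnA.
  apply: leq_mul (realizes_leq_card m0 (realizes_rot (realizes_rot rG))).
  exact: leq_mul (realizes_leq_card p0 rG) (realizes_leq_card n0 (realizes_rot rG)).
by rewrite divfK // gt_eqF // ln_gt0 // ltr1n.
Qed.

End PseudoExponent.

Theorem corollary4p2 (R : realType) (gT : finGroupType) (G : {group gT}) :
  ((pseudo_exponent R G)%:E < gamma R G)%E ->
  matmul_exponent R <=
    pseudo_exponent R G * gamma_ratio (pseudo_exponent R G) (gamma R G).
Proof.
have [/card1_trivg G1 _|G1] := eqVneq #|G| 1%N.
  have abG : abelian G by rewrite G1 abelian1.
  rewrite /pseudo_exponent /gamma abG G1 cards1 eqxx mulr1.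
  exact: matmul_exponent_le3.
have {}G1 : (1 < #|G|)%N by rewrite ltn_neqAle eq_sym G1 cardG_gt0.
have [n [m [p [rG N1 Nle]]]] := pseudo_exponent_realized R G1.
set al := pseudo_exponent R G; set om := matmul_exponent R => alE.
have key := @realizes_matmul_exponent R _ _ _ _ _ rG N1; rewrite -/om in key.
move: key Nle alE; set N := (n * m * p)%N in N1 *; set d := max_degree R G => key Nle alE.
have lnN : 0 < ln N%:R :> R by rewrite ln_gt0 // ltr1n.
have lnG : 0 < ln #|G|%:R :> R by rewrite ln_gt0 // ltr1n.
have al2 : 2 <= al.
  rewrite -(ler_pM2r lnN) alE !mulr_natl -!lnXn ?ltr0n ?(ltnW N1) ?cardG_gt0 //.
  by rewrite ler_ln ?posrE ?exprn_gt0 ?ltr0n ?(ltnW N1) ?cardG_gt0 // -!natrX ler_nat.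
(* For abelian G all degrees are 1, so the term in [ln d] vanishes and [key] reads om ln N <= al ln
   N. *)
have [abG|nabG] := boolP (abelian G).
  rewrite /gamma abG mulr1 => _; have [om2|om2] := leP om 2; first exact: le_trans al2.
  have d1 : d = 1%N.
    apply/eqP; rewrite eqn_leq max_degree_gt0 andbT.
    pose sG := DecSocleType (regular_repr R[i] G).
    have [i di] := irreducible_degreeP sG (irreducible_degree_max R G).
    by rewrite /d -di (irr_degree_abelian (@group_closure_closed_field R[i] gT G) abG).
  have := key om2; rewrite d1 ln1 mulr0 add0r -alE.
  by rewrite ler_pM2r.
have lnd : 0 < ln d%:R :> R by rewrite ln_gt0 // ltr1n max_degree_gt1.
rewrite /gamma (negPf nabG) -/d lte_fin /= => algam.
set gam := _ / _ in algam *.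
have gamE : ln #|G|%:R = gam * ln d%:R by rewrite divfK // gt_eqF.
clearbody gam; rewrite mulrA ler_pdivlMr ?subr_gt0 //.
(* For om <= 2 it suffices that 2 (gam - al) <= al (gam - 2), which amounts to gam (al - 2) >= 0. *)
have [om2|om2] := leP om 2.
  apply: (@le_trans _ _ (2 * (gam - al))); first by rewrite ler_wpM2r // subr_ge0 ltW.
  have : 0 <= gam * (al - 2).
    by rewrite mulr_ge0 ?subr_ge0 // ltW // (le_lt_trans _ algam) // (le_trans _ al2).
  lra.
have al0 : 0 < al by exact: lt_le_trans al2.
(* This is [key] multiplied by al, using al ln N = 3 ln #|G| and ln #|G| = gam ln d. Cancelling ln d
   and rearranging gives om (gam - al) <= al (gam - 2). *)
have : om * (gam * ln d%:R) <= al * ((om - 2 + gam) * ln d%:R).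
  have := ler_wpM2l (ltW al0) (key om2); rewrite mulrCA alE gamE => h; lra.
rewrite !mulrA ler_pM2r // => h; lra.
Qed.
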